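(* Let $\mathcal{D}$ be a triangulated category with a presilting subcategory $\mathcal{P}$ such that $\mathcal{P}$ is contravariantly finite in $\mathcal{D}$, there is an integer $m<0$ with $\operatorname{Hom}(\mathcal{P},\mathcal{P}[i])=0$ for all $i<m$, and $(\mathcal{D}^{\le 0}_{\mathcal{P}},\mathcal{D}^{\ge 0}_{\mathcal{P}})$ is a non-degenerate $t$-structure on $\mathcal{D}$. Let $d$ be a positive integer and $d\text{-}\mathcal{H}=\mathcal{D}^{[-d+1,0]}$. Then every AIR tilting subcategory of $d\text{-}\mathcal{H}$ is quasi-tilting.
   Context: Conventions: $[1]$ is the shift functor of a triangulated category. $\operatorname{add}\mathcal{X}$ is the full subcategory of direct summands of finite direct sums of objects of $\mathcal{X}$. A subcategory of an additive category means a full subcategory $\mathcal{X}$ with $\mathcal{X}=\operatorname{add}\mathcal{X}$. $\operatorname{Hom}(\mathcal{X},\mathcal{Y})=0$ means $\operatorname{Hom}(X,Y)=0$ for all $X\in\mathcal{X}$, $Y\in\mathcal{Y}$. A morphism $f:X\to Y$ is a right $\mathcal{X}$-approximation of $Y$ if $X\in\mathcal{X}$ and every morphism $X'\to Y$ with $X'\in\mathcal{X}$ factors through $f$; $\mathcal{X}$ is contravariantly finite in $\mathcal{C}$ if every object of $\mathcal{C}$ has a right $\mathcal{X}$-approximation. $\mathcal{P}$ is presilting if $\operatorname{Hom}(\mathcal{P},\mathcal{P}[i])=0$ for all $i>0$. $\mathcal{D}^{\le 0}_{\mathcal{P}}=\{Y\in\mathcal{D}\mid \operatorname{Hom}(\mathcal{P},Y[i])=0\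 \forall i>0\}$, $\mathcal{D}^{\ge 0}_{\mathcal{P}}=\{Y\in\mathcal{D}\mid \operatorname{Hom}(\mathcal{P},Y[i])=0\ \forall i<0\}$, $\mathcal{D}^{\le q}=\mathcal{D}^{\le 0}_{\mathcal{P}}[-q]$, $\mathcal{D}^{\ge q}=\mathcal{D}^{\ge 0}_{\mathcal{P}}[-q]$, $\mathcal{D}^{[p,q]}=\mathcal{D}^{\le q}\cap\mathcal{D}^{\ge p}$, and $H^{[p,q]}=\sigma^{\ge p}\circ\sigma^{\le q}:\mathcal{D}\to\mathcal{D}^{[p,q]}$ with $\sigma$ the truncations of the $t$-structure $(\mathcal{D}^{\le 0}_{\mathcal{P}},\mathcal{D}^{\ge 0}_{\mathcal{P}})$. $\mathcal{K}=\operatorname{thick}(\mathcal{P})$ is the smallest triangulated subcategory of $\mathcal{D}$ closed under direct summands and containing $\mathcal{P}$. $\mathcal{X}*\mathcal{Y}$ is the full subcategory of objects $Z$ admitting a triangle $X\to Z\to Y\to X[1]$ with $X\in\mathcal{X}$, $Y\in\mathcal{Y}$; $\mathcal{P}^{[0,d]}=\mathcal{P}*\mathcal{P}[1]*\cdots*\mathcal{P}[d]$. A subcategory $\mathcal{S}$ of $\mathcal{K}$ is $(d+1)$-term if $\mathcal{S}\subseteq\mathcal{P}^{[0,d]}$. For $M,N\in d\text{-}\mathcal{H}$ put $\mathbb{E}(M,N)=\operatorname{Hom}(M,N[1])$. An extriangle is a sequence $N\to L\to M$ with $N,L,M\in d\text{-}\mathcal{H}$ that is part of a triangle $N\to L\to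 M\to N[1]$ in $\mathcal{D}$. For a full subcategory $\mathcal{X}$ of $d\text{-}\mathcal{H}$ and $s\ge1$, $\operatorname{Fac}_s(\mathcal{X})$ is the full subcategory of objects $Z_0\in d\text{-}\mathcal{H}$ for which there are extriangles $Z_i\to X_i\to Z_{i-1}$, $1\le i\le s$, with $X_1,\dots,X_s\in\mathcal{X}$. For a $(d+1)$-term subcategory $\mathcal{S}$ of $\mathcal{K}$, $\mathcal{T}(\mathcal{S})=\{X\in d\text{-}\mathcal{H}\mid\operatorname{Hom}(\mathcal{S},X[i])=0\ \forall i>0\}$. A $\mathcal{P}$-presentation of a subcategory $\mathcal{M}\subseteq d\text{-}\mathcal{H}$ is a $(d+1)$-term subcategory $\mathcal{S}$ of $\mathcal{K}$ with $\operatorname{add}\{H^{[-d+1,0]}(S)\mid S\in\mathcal{S}\}=\mathcal{M}$. $\mathcal{M}$ is AIR tilting with respect to its $\mathcal{P}$-presentation $\mathcal{S}$ if $\mathcal{S}$ is contravariantly finite in $\mathcal{D}$ and $\mathcal{T}(\mathcal{S})=\operatorname{Fac}_d(\mathcal{M})$; $\mathcal{M}$ is AIR tilting if it is so with respect to some $\mathcal{P}$-presentation. An object $M$ of a full subcategory $\mathcal{X}\subseteq d\text{-}\mathcal{H}$ is $\mathbb{E}$-projective in $\mathcal{X}$ if $\mathbb{E}(M,X)=0$ for all $X\in\mathcal{X}$. A subcategory $\mathcal{M}$ of $d\text{-}\mathcal{H}$ is quasi-tilting if every object of $\mathcal{M}$ is $\mathbb{E}$-projective in $\operatorname{Fac}_d(\mathcal{M})$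 and $\operatorname{Fac}_d(\mathcal{M})=\operatorname{Fac}_{d+1}(\mathcal{M})$. *)

(* Defs.v *)
From HB Require Import structures.
From mathcomp Require Import all_boot all_order all_algebra.

Set Implicit Arguments.
Unset Strict Implicit.
Unset Printing Implicit Defensive.

Import Order.TTheory GRing.Theory Num.Theory.
Local Open Scope ring_scope.

Record preadditive_category := PreadditiveCategory {
  obj :> Type;
  Hom : obj -> obj -> zmodType;
  idm : forall X : obj, Hom X X;
  comp : forall X Y Z : obj, Hom Y Z -> Hom X Y -> Hom X Z;
  comp_idl : forall X Y (f : Hom X Y), comp (idm Y) f = f;
  comp_idr : forall X Y (f : Hom X Y), comp f (idm X) = f;
  comp_assoc : forall W X Y Z (h : Hom Y Z) (g : Hom X Y) (f : Hom W X),
    comp h (comp g f) = comp (comp h g) f;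
  comp_addl : forall X Y Z (g g' : Hom Y Z) (f : Hom X Y),
    comp (g + g') f = comp g f + comp g' f;
  comp_addr : forall X Y Z (g : Hom Y Z) (f f' : Hom X Y),
    comp g (f + f') = comp g f + comp g f'
}.

Arguments Hom {p} X Y.
Arguments idm {p} X.
Arguments comp {p X Y Z} g f.

Notation "g ∘ f" := (comp g f) (at level 40, left associativity).

Section Preadditive.
Variable C : preadditive_category.
Implicit Types X Y Z S : C.

Definition is_iso X Y (f : Hom X Y) : Prop :=
  exists g : Hom Y X, g ∘ f = idm X /\ f ∘ g = idm Y.

Definition isomorphic X Y : Prop := exists f : Hom X Y, is_iso f.

Definition Hom_zero X Y : Prop := forall f : Hom X Y, f = 0.

Definition is_zero_obj Z : Prop :=
  forall X, Hom_zero X Z /\ Hom_zero Z X.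

Definition is_dirsum X Y S : Prop :=
  exists (i1 : Hom X S) (i2 : Hom Y S) (p1 : Hom S X) (p2 : Hom S Y),
    [/\ p1 ∘ i1 = idm X, p2 ∘ i2 = idm Y, p2 ∘ i1 = 0, p1 ∘ i2 = 0
      & i1 ∘ p1 + i2 ∘ p2 = idm S].

Definition is_finite_dirsum n (X : 'I_n -> C) S : Prop :=
  exists (i : forall k, Hom (X k) S) (p : forall k, Hom S (X k)),
    [/\ forall k, p k ∘ i k = idm (X k),
        forall k l, k != l -> p l ∘ i k = 0
      & \sum_(k < n) i k ∘ p k = idm S].

End Preadditive.

Record additive_category := AdditiveCategory {
  add_base :> preadditive_category;
  zero_obj_exists : exists Z : add_base, is_zero_obj Z;
  dirsum_exists : forall X Y : add_base, exists S, is_dirsum X Y S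
}.

Record additive_functor (C C' : preadditive_category) := AdditiveFunctor {
  fobj :> C -> C';
  fmap : forall X Y : C, Hom X Y -> Hom (fobj X) (fobj Y);
  fmap_id : forall X, fmap (idm X) = idm (fobj X);
  fmap_comp : forall X Y Z (g : Hom Y Z) (f : Hom X Y),
    fmap (g ∘ f) = fmap g ∘ fmap f;
  fmap_add : forall X Y (f g : Hom X Y), fmap (f + g) = fmap f + fmap g
}.

Arguments fmap {C C'} F {X Y} f : rename.

(* The shift is an autoequivalence, not necessarily a strict automorphism:
   [shiftV] is a quasi-inverse. *)
Record triangulated_category := TriangulatedCategory {
  tri_base :> additive_category;
  shift : additive_functor tri_base tri_base;
  shiftV : additive_functor tri_base tri_base;
  shift_unit : forall X : tri_base, Hom X (shiftV (shift X));
  shift_unit_iso : forall X, is_iso (shift_unit X);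
  shift_unit_nat : forall X Y (f : Hom X Y),
    fmap shiftV (fmap shift f) ∘ shift_unit X = shift_unit Y ∘ f;
  shift_counit : forall X : tri_base, Hom (shift (shiftV X)) X;
  shift_counit_iso : forall X, is_iso (shift_counit X);
  shift_counit_nat : forall X Y (f : Hom X Y),
    f ∘ shift_counit X = shift_counit Y ∘ fmap shift (fmap shiftV f);
  triangle : forall X Y Z : tri_base,
    Hom X Y -> Hom Y Z -> Hom Z (shift X) -> Prop;
  triangle_iso : forall X Y Z X' Y' Z'
      (f : Hom X Y) (g : Hom Y Z) (h : Hom Z (shift X))
      (f' : Hom X' Y') (g' : Hom Y' Z') (h' : Hom Z' (shift X'))
      (u : Hom X X') (v : Hom Y Y') (w : Hom Z Z'),
    is_iso u -> is_iso v -> is_iso w ->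
    v ∘ f = f' ∘ u -> w ∘ g = g' ∘ v -> fmap shift u ∘ h = h' ∘ w ->
    triangle f g h -> triangle f' g' h';
  triangle_id : forall X Z : tri_base,
    is_zero_obj Z -> triangle (idm X) (0 : Hom X Z) 0;
  triangle_cone : forall X Y (f : Hom X Y),
    exists Z (g : Hom Y Z) (h : Hom Z (shift X)), triangle f g h;
  triangle_rot : forall X Y Z
      (f : Hom X Y) (g : Hom Y Z) (h : Hom Z (shift X)),
    triangle f g h <-> triangle g h (- fmap shift f);
  triangle_mor : forall X Y Z X' Y' Z'
      (f : Hom X Y) (g : Hom Y Z) (h : Hom Z (shift X))
      (f' : Hom X' Y') (g' : Hom Y' Z') (h' : Hom Z' (shift X'))
      (u : Hom X X') (v : Hom Y Y'),
    triangle f g h -> triangle f' g' h' -> v ∘ f = f' ∘ u ->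
    exists w : Hom Z Z', w ∘ g = g' ∘ v /\ fmap shift u ∘ h = h' ∘ w;
  triangle_octa : forall X Y Z U V W
      (f : Hom X Y) (f1 : Hom Y U) (f2 : Hom U (shift X))
      (g : Hom Y Z) (g1 : Hom Z W) (g2 : Hom W (shift Y))
      (k1 : Hom Z V) (k2 : Hom V (shift X)),
    triangle f f1 f2 -> triangle g g1 g2 -> triangle (g ∘ f) k1 k2 ->
    exists (a : Hom U V) (b : Hom V W),
      [/\ triangle a b (fmap shift f1 ∘ g2),
          a ∘ f1 = k1 ∘ g, k2 ∘ a = f2,
          b ∘ k1 = g1 & g2 ∘ b = fmap shift f ∘ k2]
}.

Definition shiftz (D : triangulated_category) (X : D) (n : int) : D :=
  match n with
  | Posz k => iter k (shift D) X
  | Negz k => iter k.+1 (shiftV D) X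
  end.

Notation "X ⟦ n ⟧" := (shiftz X n%R) (at level 2, format "X ⟦ n ⟧").

Section Subcategories.
Variable D : triangulated_category.

Definition subcat := D -> Prop.

Implicit Types (X Y Z W : D) (A B P S : subcat) (p q n : int).

Definition sub_incl A B : Prop := forall X, A X -> B X.
Definition sub_eq A B : Prop := forall X, A X <-> B X.

Definition sub_add A : subcat := fun Y =>
  exists (m : nat) (X : 'I_m -> D) (T Y' : D),
    [/\ forall k, A (X k), is_finite_dirsum X T & is_dirsum Y Y' T].

Definition is_subcategory A : Prop := sub_eq A (sub_add A).

Definition sub_Hom_zero A B : Prop :=
  forall X Y, A X -> B Y -> Hom_zero X Y.

Definition Hom_from_zero A Y : Prop := forall X, A X -> Hom_zero X Y.

Definition sub_shift A n : subcat := fun Z =>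
  exists2 Y, A Y & isomorphic Z Y⟦n⟧.

Definition sub_star A B : subcat := fun Z =>
  exists X Y (f : Hom X Z) (g : Hom Z Y) (h : Hom Y (shift D X)),
    [/\ A X, B Y & triangle f g h].

Definition right_approximation A X Y (f : Hom X Y) : Prop :=
  A X /\ forall X' (g : Hom X' Y), A X' -> exists g' : Hom X' X, g = f ∘ g'.

Definition contravariantly_finite A : Prop :=
  forall Y, exists X (f : Hom X Y), right_approximation A f.

Definition is_thick A : Prop :=
  [/\ forall Z, is_zero_obj Z -> A Z,
      forall X, A X -> A (shift D X) /\ A (shiftV D X),
      forall X Y Z (f : Hom X Y) (g : Hom Y Z) (h : Hom Z (shift D X)),
        triangle f g h -> A X -> A Y -> A Z
    & forall X Y Z, is_dirsum X Y Z -> A Z -> A X].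

Definition thick A : subcat := fun X =>
  forall B, is_thick B -> sub_incl A B -> B X.

(* A t-structure is written (D^{<=0}, D^{>=0}) = (A, B). *)
Definition is_tstructure A B : Prop :=
  [/\ is_subcategory A /\ is_subcategory B,
      sub_incl (sub_shift A 1) A,
      sub_incl (sub_shift B (-1)) B,
      sub_Hom_zero A (sub_shift B (-1))
    & forall X, sub_star A (sub_shift B (-1)) X].

Definition is_nondegenerate A B : Prop :=
  (forall X, (forall n, sub_shift A n X) -> is_zero_obj X) /\
  (forall X, (forall n, sub_shift B n X) -> is_zero_obj X).

Definition presilting P : Prop :=
  forall i : int, 0 < i -> sub_Hom_zero P (sub_shift P i).

Definition Dle0 P : subcat := fun Y =>
  forall i : int, 0 < i -> Hom_from_zero P Y⟦i⟧.

Definition Dge0 P : subcat := fun Y =>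
  forall i : int, i < 0 -> Hom_from_zero P Y⟦i⟧.

Definition Dle P q : subcat := sub_shift (Dle0 P) (- q).
Definition Dge P p : subcat := sub_shift (Dge0 P) (- p).
Definition Dint P p q : subcat := fun X => Dle P q X /\ Dge P p X.

(* [is_trunc_le P q X Y] means Y = sigma^{<=q} X, [is_trunc_ge P p X Y] means
   Y = sigma^{>=p} X, and [is_H P p q X Y] means Y = H^{[p,q]}(X); truncations
   are determined up to isomorphism by the truncation triangles. *)
Definition is_trunc_le P q X Y : Prop :=
  exists Z (f : Hom Y X) (g : Hom X Z) (h : Hom Z (shift D Y)),
    [/\ Dle P q Y, Dge P (q + 1) Z & triangle f g h].

Definition is_trunc_ge P p X Y : Prop :=
  exists Z (f : Hom Z X) (g : Hom X Y) (h : Hom Y (shift D Z)),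
    [/\ Dle P (p - 1) Z, Dge P p Y & triangle f g h].

Definition is_H P p q X Y : Prop :=
  exists2 W, is_trunc_le P q X W & is_trunc_ge P p W Y.

(* P * P[1] * ... * P[d] *)
Fixpoint Pterm P (d : nat) : subcat :=
  if d is d'.+1 then sub_star (Pterm P d') (sub_shift P d%:Z) else P.

Definition term_subcategory P (d : nat) S : Prop :=
  [/\ is_subcategory S, sub_incl S (thick P) & sub_incl S (Pterm P d)].

Section ExtendedHeart.
Variables (P : subcat) (d : nat).

Definition dH : subcat := Dint P (- d%:Z + 1) 0.

Definition EE_zero X Y : Prop := Hom_zero X Y⟦1⟧.

Definition extriangle (N L M : D) : Prop :=
  [/\ dH N, dH L, dH M
    & exists (f : Hom N L) (g : Hom L M) (h : Hom M (shift D N)),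
        triangle f g h].

(* The chain Z_s -> X_s -> Z_{s-1}, ..., Z_1 -> X_1 -> Z_0, unfolded from
   Z_0. *)
Fixpoint Fac (s : nat) (A : subcat) : subcat := fun Z0 =>
  if s is s'.+1 then
    exists X1 Z1 : D, [/\ A X1, extriangle Z1 X1 Z0 & Fac s' A Z1]
  else dH Z0.

Definition TT S : subcat := fun X =>
  dH X /\ forall i : int, 0 < i -> Hom_from_zero S X⟦i⟧.

Definition subcategory_of_dH (M : subcat) : Prop :=
  is_subcategory M /\ sub_incl M dH.

Definition P_presentation (M S : subcat) : Prop :=
  term_subcategory P d S /\
  sub_eq (sub_add (fun Y => exists2 X, S X & is_H P (- d%:Z + 1) 0 X Y)) M.

Definition AIR_tilting_wrt (M S : subcat) : Prop :=
  [/\ P_presentation M S, contravariantly_finite S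
    & sub_eq (TT S) (Fac d M)].

Definition AIR_tilting (M : subcat) : Prop :=
  subcategory_of_dH M /\ exists S, AIR_tilting_wrt M S.

Definition EE_projective_in (A : subcat) (M : D) : Prop :=
  A M /\ forall X, A X -> EE_zero M X.

Definition quasi_tilting (M : subcat) : Prop :=
  [/\ subcategory_of_dH M,
      forall X, M X -> EE_projective_in (Fac d M) X
    & sub_eq (Fac d M) (Fac d.+1 M)].

End ExtendedHeart.
End Subcategories.

(* Main.v *)
(** Write [T(S) = Fac_d(M)].  For [U] in [S] there is a triangle
    [V -> U -> H(U) -> V[1]] with [V] in [D^{<=-d}], and [Hom(V, X) = 0] for
    every [X] in the extended heart; so [Hom(U, X[1]) = 0] forces
    [Hom(H(U), X[1]) = 0], and every map [U -> X] factors through [H(U)].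
    Given [X] in [T(S)], factor an [S]-approximation [U0 -> X] as
    [U0 -> H(U0) -> X] and let [Y -> H(U0) -> X -> Y[1]] be a triangle.  Since
    [X] is in [Fac_1(M)], every map from [P] to [X] lifts to [H(U0)], which puts
    [Y] in the extended heart; since [U0 -> X] is an approximation, [Y] is in
    [T(S) = Fac_d(M)].  Hence [X] is in [Fac_{d+1}(M)]. *)
From mathcomp Require Import all_boot all_order all_algebra zify.
Require Import Defs.
Local Open Scope ring_scope.

Set Implicit Arguments.
Unset Strict Implicit.
Unset Printing Implicit Defensive.
Import Order.TTheory GRing.Theory Num.Theory.

(** * Bilinearity of composition, isomorphisms and additive functors *)

Section Preadditive.
Variable C : preadditive_category.
Implicit Types X Y Z : C.

Lemma comp0r X Y Z (g : Hom Y Z) : g ∘ (0 : Hom X Y) = 0.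
Proof. by apply: (addrI (g ∘ 0)); rewrite -comp_addr !addr0. Qed.

Lemma comp0l X Y Z (f : Hom X Y) : (0 : Hom Y Z) ∘ f = 0.
Proof. by apply: (addrI (0 ∘ f)); rewrite -comp_addl !addr0. Qed.

Lemma compNr X Y Z (g : Hom Y Z) (f : Hom X Y) : g ∘ (- f) = - (g ∘ f).
Proof. by apply: (addrI (g ∘ f)); rewrite -comp_addr !subrr comp0r. Qed.

Lemma compNl X Y Z (g : Hom Y Z) (f : Hom X Y) : (- g) ∘ f = - (g ∘ f).
Proof. by apply: (addrI (g ∘ f)); rewrite -comp_addl !subrr comp0l. Qed.

Lemma comp_suml X Y Z n (F : 'I_n -> Hom Y Z) (f : Hom X Y) :
  (\sum_(k < n) F k) ∘ f = \sum_(k < n) F k ∘ f.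
Proof.
apply: (big_morph (fun g => g ∘ f)); last exact: comp0l.
by move=> ? ?; apply: comp_addl.
Qed.

Lemma comp_sumr X Y Z n (g : Hom Y Z) (F : 'I_n -> Hom X Y) :
  g ∘ (\sum_(k < n) F k) = \sum_(k < n) g ∘ F k.
Proof.
apply: (big_morph (fun f => g ∘ f)); last exact: comp0r.
by move=> ? ?; apply: comp_addr.
Qed.

Lemma is_iso_id X : is_iso (idm X).
Proof. by exists (idm X); rewrite comp_idl. Qed.

Lemma isomorphic_refl X : isomorphic X X.
Proof. by exists (idm X); apply: is_iso_id. Qed.

Lemma isomorphic_sym X Y : isomorphic X Y -> isomorphic Y X.
Proof. by case=> f [g [gf fg]]; exists g, f. Qed.

Lemma isomorphic_trans X Y Z :
  isomorphic X Y -> isomorphic Y Z -> isomorphic X Z.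
Proof.
case=> f [f' [f'f ff']] [g [g' [g'g gg']]].
exists (g ∘ f), (f' ∘ g'); split.
  by rewrite comp_assoc -(comp_assoc f') g'g comp_idr.
by rewrite comp_assoc -(comp_assoc g) ff' comp_idr.
Qed.

Lemma iso_epi X Y Z (u : Hom X Y) (f : Hom Y Z) :
  is_iso u -> f ∘ u = 0 -> f = 0.
Proof.
by case=> v [_ uv] fu; rewrite -(comp_idr f) -uv comp_assoc fu comp0l.
Qed.

Lemma iso_mono X Y Z (u : Hom Y Z) (f : Hom X Y) :
  is_iso u -> u ∘ f = 0 -> f = 0.
Proof.
by case=> v [vu _] uf; rewrite -(comp_idl f) -vu -comp_assoc uf comp0r.
Qed.

Lemma Hom_zero_iso X X' Y Y' :
  isomorphic X X' -> isomorphic Y Y' -> Hom_zero X Y -> Hom_zero X' Y'.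
Proof.
move=> [u iu] [v [v' [v'v vv']]] XY f.
apply: (iso_epi iu); rewrite -[_ ∘ u]comp_idl -vv' -comp_assoc.
by rewrite (XY (v' ∘ _)) comp0r.
Qed.

Lemma zero_objP Z : is_zero_obj Z <-> idm Z = 0.
Proof.
split=> [/(_ Z) [ZZ _]|Z0 X]; first exact: ZZ.
by split=> f; [rewrite -(comp_idl f) Z0 comp0l | rewrite -(comp_idr f) Z0 comp0r].
Qed.

Lemma dirsum_zero X Z : is_zero_obj Z -> is_dirsum X Z X.
Proof.
move=> Z0; exists (idm X), 0, (idm X), 0.
split; rewrite ?comp_idl ?comp0l ?comp0r ?addr0 //.
by symmetry; apply/zero_objP.
Qed.

End Preadditive.

Section AdditiveFunctor.
Variables (C C' : preadditive_category) (F : additive_functor C C').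
Implicit Types X Y : C.

Lemma fmap0 X Y : fmap F (0 : Hom X Y) = 0.
Proof. by apply: (addrI (fmap F 0)); rewrite -fmap_add !addr0. Qed.

Lemma fmapN X Y (f : Hom X Y) : fmap F (- f) = - fmap F f.
Proof. by apply: (addrI (fmap F f)); rewrite -fmap_add !subrr fmap0. Qed.

Lemma fmap_isomorphic X Y : isomorphic X Y -> isomorphic (F X) (F Y).
Proof.
case=> f [g [gf fg]]; exists (fmap F f), (fmap F g).
by rewrite -!fmap_comp gf fg !fmap_id.
Qed.

Lemma fmap_zero_obj X : is_zero_obj X -> is_zero_obj (F X).
Proof. by rewrite !zero_objP -fmap_id => ->; apply: fmap0. Qed.

End AdditiveFunctor.

(** * The shift as an autoequivalence and its integer powers *)

Section Shift.
Variable D : triangulated_category.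
Implicit Types (X Y Z Q : D) (n i : int).

Lemma shiftV_faithful X Y (f : Hom X Y) : fmap (shiftV D) f = 0 -> f = 0.
Proof.
move=> Vf; apply: (iso_epi (shift_counit_iso X)).
by rewrite shift_counit_nat Vf fmap0 comp0r.
Qed.

Lemma shift_faithful X Y (f : Hom X Y) : fmap (shift D) f = 0 -> f = 0.
Proof.
move=> Sf; apply: (iso_mono (shift_unit_iso Y)).
by rewrite -shift_unit_nat Sf fmap0 comp0l.
Qed.

(** The preimage is the conjugate of [fmap (shiftV D) f] by the units; naturality of the unit shows
    that both sides agree after the faithful functor [shiftV]. *)
Lemma shift_full X Y (f : Hom (shift D X) (shift D Y)) :
  exists f' : Hom X Y, fmap (shift D) f' = f.
Proof.
have [v [vu uv]] := shift_unit_iso Y.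
exists (v ∘ (fmap (shiftV D) f ∘ shift_unit X)).
apply/eqP; rewrite -subr_eq0; apply/eqP; apply: shiftV_faithful.
apply: (iso_epi (shift_unit_iso X)).
by rewrite fmap_add fmapN comp_addl compNl shift_unit_nat comp_assoc uv
  comp_idl subrr.
Qed.

Lemma shiftz_iso X Y n : isomorphic X Y -> isomorphic X⟦n⟧ Y⟦n⟧.
Proof.
case: n => k XY; elim: k => [|k IHk] //; exact: fmap_isomorphic.
Qed.

Lemma shiftz_shift X i : isomorphic (shift D X)⟦i⟧ X⟦1 + i⟧.
Proof.
have VS : isomorphic (shiftV D (shift D X)) X.
  by apply: isomorphic_sym; exists (shift_unit X); apply: shift_unit_iso.
case: i => [k|[|k]].
- rewrite -PoszD add1n /= -iterS iterSr; exact: isomorphic_refl.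
- exact: VS.
- have -> : 1 + Negz k.+1 = Negz k by lia.
  rewrite {1}/shiftz iterSr; exact: (@shiftz_iso _ _ (Negz k) VS).
Qed.

Lemma shiftz_shiftV X i : isomorphic (shiftV D X)⟦i⟧ X⟦-1 + i⟧.
Proof.
have SV : isomorphic (shift D (shiftV D X)) X.
  by exists (shift_counit X); apply: shift_counit_iso.
case: i => [[|k]|k].
- exact: isomorphic_refl.
- have -> : -1 + Posz k.+1 = Posz k by lia.
  rewrite {1}/shiftz iterSr; exact: (@shiftz_iso _ _ (Posz k) SV).
- have -> : -1 + Negz k = Negz k.+1 by lia.
  rewrite {1}/shiftz -iterSr; exact: isomorphic_refl.
Qed.

Lemma shiftzD X n i : isomorphic X⟦n⟧⟦i⟧ X⟦n + i⟧.
Proof.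
case: n => k; elim: k i => [|k IHk] i.
- by rewrite add0r; apply: isomorphic_refl.
- apply: isomorphic_trans (shiftz_shift X⟦k⟧ i) _.
  have -> : Posz k.+1 + i = Posz k + (1 + i) by lia.
  exact: IHk.
- exact: shiftz_shiftV.
- apply: isomorphic_trans (shiftz_shiftV X⟦Negz k⟧ i) _.
  have -> : Negz k.+1 + i = Negz k + (-1 + i) by lia.
  exact: IHk.
Qed.

Lemma shiftzK X n i : n + i = 0 -> isomorphic X⟦n⟧⟦i⟧ X.
Proof. by move=> ni; have := shiftzD X n i; rewrite ni. Qed.

Lemma Hom_zero_shift X Y : Hom_zero X Y -> Hom_zero (shift D X) (shift D Y).
Proof. by move=> XY f; have [f' <-] := shift_full f; rewrite (XY f') fmap0. Qed.

Lemma Hom_zero_shiftz X Y n : Hom_zero X Y -> Hom_zero X⟦n⟧ Y⟦n⟧.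
Proof.
case: n => k XY.
  by elim: k => [//|k IHk]; apply: Hom_zero_shift.
elim: k => [|k IHk].
  (* Vanishing is tested after one forward shift, where the counits cancel the outermost [shiftV] on
     both sides. *)
  move=> f /=; apply: shift_faithful; move: (fmap _ f).
  by apply: Hom_zero_iso XY; apply: isomorphic_sym; [exists (shift_counit X)
    |exists (shift_counit Y)]; apply: shift_counit_iso.
move=> f /=; apply: shift_faithful; move: (fmap _ f).
by apply: Hom_zero_iso IHk; apply: isomorphic_sym; [exists (shift_counit _)
    |exists (shift_counit _)]; apply: shift_counit_iso.
Qed.

Lemma Hom_zero_shiftzD Q X n i :
  Hom_zero Q X⟦n⟧⟦i⟧ <-> Hom_zero Q X⟦n + i⟧.
Proof.
split; apply: Hom_zero_iso; do ?exact: isomorphic_refl.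
  exact: shiftzD.
by apply: isomorphic_sym; apply: shiftzD.
Qed.

(** Moving the shift to the source lets exactness of a triangle be used in every degree without
    shifting the triangle. *)
Lemma Hom_zero_adj Q X i : Hom_zero Q X⟦i⟧ <-> Hom_zero Q⟦- i⟧ X.
Proof.
split=> /Hom_zero_shiftz h.
  apply: Hom_zero_iso (h (- i)); first exact: isomorphic_refl.
  by apply: shiftzK; rewrite subrr.
apply: Hom_zero_iso (h i); last exact: isomorphic_refl.
by apply: shiftzK; rewrite addNr.
Qed.

End Shift.

(** * Exactness of Hom on triangles, cocones and shifted triangles *)

Section Triangles.
Variable D : triangulated_category.
Implicit Types (X Y Z Q T : D) (i : int).

Lemma triangle_zero_left X O :
  is_zero_obj O -> triangle (0 : Hom O X) (idm X) (0 : Hom X (shift D O)).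
Proof.
move=> O0; apply/triangle_rot; rewrite fmap0 oppr0.
by apply: triangle_id; apply: fmap_zero_obj.
Qed.

Section Exactness.
Variables (X Y Z : D) (f : Hom X Y) (g : Hom Y Z) (h : Hom Z (shift D X)).
Hypothesis tri : triangle f g h.

Lemma triangle_comp0 : g ∘ f = 0.
Proof.
have [O O0] := zero_obj_exists D.
have [w [<- _]] := triangle_mor (triangle_id X O0) tri
  (erefl _ : f ∘ idm X = f ∘ idm X).
exact: comp0r.
Qed.

Lemma triangle_lift Q (u : Hom Q Y) : g ∘ u = 0 -> exists v, u = f ∘ v.
Proof.
move=> gu0; have [O O0] := zero_obj_exists D.
have triQ := (triangle_rot _ _ _).1 (triangle_id Q O0).
have triY := (triangle_rot _ _ _).1 tri.
have sq : (0 : Hom O Z) ∘ (0 : Hom Q O) = g ∘ u by rewrite gu0 comp0r.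
(* The rotated identity triangle [Q -> O -> Q[1]] maps to the rotation of [tri]; by fullness the
   third component is the shift of the wanted lift, and the rotation signs cancel. *)
have [w [_]] := triangle_mor triQ triY sq.
have [v <-] := shift_full w.
rewrite fmap_id compNr comp_idr compNl -fmap_comp => /oppr_inj Suv.
exists v; apply/eqP; rewrite -subr_eq0; apply/eqP; apply: shift_faithful.
by rewrite fmap_add fmapN Suv subrr.
Qed.

Lemma triangle_desc T (u : Hom Y T) : u ∘ f = 0 -> exists v, u = v ∘ g.
Proof.
move=> uf0; have [O O0] := zero_obj_exists D.
have sq : u ∘ f = (0 : Hom O T) ∘ (0 : Hom X O) by rewrite uf0 comp0r.
have [v [vg _]] := triangle_mor tri (triangle_zero_left T O0) sq.
by exists v; rewrite vg comp_idl.
Qed.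

Lemma Hom_zero_mid Q i :
  Hom_zero Q X⟦i⟧ -> Hom_zero Q Z⟦i⟧ -> Hom_zero Q Y⟦i⟧.
Proof.
rewrite !Hom_zero_adj => QX QZ u.
by have [v ->] := triangle_lift (QZ (g ∘ u)); rewrite (QX v) comp0r.
Qed.

End Exactness.

Lemma Hom_zero_last X Y Z (f : Hom X Y) (g : Hom Y Z) (h : Hom Z (shift D X))
    Q i : triangle f g h ->
  Hom_zero Q Y⟦i⟧ -> Hom_zero Q X⟦1 + i⟧ -> Hom_zero Q Z⟦i⟧.
Proof.
move=> /triangle_rot tri QY QX; apply: (Hom_zero_mid tri) => //.
exact/(Hom_zero_shiftzD Q X 1 i).
Qed.

Lemma Hom_zero_first X Y Z (f : Hom X Y) (g : Hom Y Z) (h : Hom Z (shift D X))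
    Q i : triangle f g h ->
  Hom_zero Q Z⟦i⟧ -> Hom_zero Q Y⟦1 + i⟧ -> Hom_zero Q X⟦1 + i⟧.
Proof.
move=> /triangle_rot/triangle_rot tri QZ QY.
apply/(Hom_zero_shiftzD Q X 1 i); apply: (Hom_zero_mid tri) => //.
exact/(Hom_zero_shiftzD Q Y 1 i).
Qed.

(** If [Hom(Q, Y) -> Hom(Q, Z)] is onto, the connecting map to [Hom(Q, X[1])] is zero, so this group
    embeds in [Hom(Q, Y[1])]. This replaces [Hom_zero_first] where [Hom(Q, Z)] itself need not
    vanish. *)
Lemma Hom_zero_shift_first X Y Z (f : Hom X Y) (g : Hom Y Z)
    (h : Hom Z (shift D X)) Q : triangle f g h ->
  (forall u : Hom Q Z, exists v, u = g ∘ v) ->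
  Hom_zero Q Y⟦1⟧ -> Hom_zero Q X⟦1⟧.
Proof.
move=> /triangle_rot tri lift QY u.
have /triangle_rot tri' := tri.
have [v ->] := triangle_lift tri' (QY (- fmap (shift D) f ∘ u)).
have [w ->] := lift v.
by rewrite comp_assoc (triangle_comp0 tri) comp0l.
Qed.

Lemma triangle_iso_mid X Y Y' Z (f : Hom X Y) (g : Hom Y Z)
    (h : Hom Z (shift D X)) (v : Hom Y Y') :
  triangle f g h -> is_iso v -> exists g' : Hom Y' Z, triangle (v ∘ f) g' h.
Proof.
move=> tri iv; have [v' [v'v vv']] := iv; exists (g ∘ v').
apply: (triangle_iso (is_iso_id X) iv (is_iso_id Z)) tri.
- by rewrite comp_idr.
- by rewrite comp_idl -comp_assoc v'v comp_idr.
- by rewrite fmap_id comp_idl comp_idr.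
Qed.

Lemma triangle_cocone Y Z (g : Hom Y Z) :
  exists X (f : Hom X Y) (h : Hom Z (shift D X)), triangle f g h.
Proof.
have [C [k [l tri]]] := triangle_cone g.
have [c' [c'c cc']] := shift_counit_iso C.
have [f Sf] := shift_full (l ∘ shift_counit C).
(* The cocone is the cone shifted back; the sign on [f] compensates the one introduced by
   rotation. *)
exists (shiftV D C), (- f), (c' ∘ k).
apply/triangle_rot; rewrite fmapN opprK Sf.
have ic' : is_iso c' by exists (shift_counit C).
apply: (triangle_iso (is_iso_id Y) (is_iso_id Z) ic') tri.
- by rewrite comp_idl comp_idr.
- by rewrite comp_idr.
- by rewrite fmap_id comp_idl -comp_assoc cc' comp_idr.
Qed.

Lemma triangle_iso_of_zero X Y Z (f : Hom X Y) (g : Hom Y Z)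
    (h : Hom Z (shift D X)) :
  triangle f g h -> is_zero_obj Z -> is_iso f.
Proof.
move=> tri Z0; have [s fs] := triangle_lift tri ((Z0 Y).1 (g ∘ idm Y)).
exists s; split=> //.
apply/eqP; rewrite -subr_eq0; apply/eqP; apply: shift_faithful.
have /triangle_rot/triangle_rot tri' := tri.
(* The section [s] is also a retraction: since [f] kills the defect [u], the shift of [u] factors
   through the zero object [Z]. *)
set u := _ - _; have fu0 : f ∘ u = 0.
  by rewrite /u comp_addr compNr comp_assoc -fs comp_idl comp_idr subrr.
have [|w ->] := triangle_lift tri' (u := fmap (shift D) u).
  by rewrite compNl -fmap_comp fu0 fmap0 oppr0.
by rewrite ((Z0 _).2 h) comp0l.
Qed.

Lemma triangle_shift_nat X Y Z (f : Hom X Y) (g : Hom Y Z)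
    (h : Hom Z (shift D X)) (n : nat) : triangle f g h ->
  exists (f' : Hom X⟦n⟧ Y⟦n⟧) (g' : Hom Y⟦n⟧ Z⟦n⟧)
    (h' : Hom Z⟦n⟧ (shift D X⟦n⟧)), triangle f' g' h'.
Proof.
move=> tri; elim: n => [|n [f' [g' [h' tri']]]]; first by exists f, g, h.
(* Three rotations amount to one shift with all three signs reversed. *)
exists (- fmap (shift D) f'), (- fmap (shift D) g'), (- fmap (shift D) h').
by do 3 apply/(triangle_rot _ _ _).1.
Qed.

End Triangles.

(** * Extending properties of maps from a class to its additive closure *)

Section AddClosure.
Variable D : triangulated_category.
Implicit Types (A : subcat D) (X Y Q B O : D).

Lemma sub_add_sub A X : A X -> sub_add A X.
Proof.
move=> AX; have [O O0] := zero_obj_exists D.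
exists 1%N, (fun=> X), X, O; split=> //; last exact: dirsum_zero.
exists (fun=> idm X), (fun=> idm X); split=> [_|k l|].
- exact: comp_idl.
- by rewrite (ord1 k) (ord1 l).
- by rewrite big_ord1 comp_idl.
Qed.

Lemma sub_add_zero A O : is_zero_obj O -> sub_add A O.
Proof.
move=> O0; exists 0%N, (fun=> O), O, O; split; last exact: dirsum_zero.
  by case.
exists (fun=> idm O), (fun=> idm O); split; try by case.
by rewrite big_ord0; symmetry; apply/zero_objP.
Qed.

(** The identity of [Y] is a sum of maps through objects of [A]. The predicate [K] is kept general
    to cover both vanishing of maps and lifting of maps along a fixed morphism. *)
Lemma sub_add_comp A Q Y B (K : Hom Q B -> Prop) :
  K 0 -> (forall a b, K a -> K b -> K (a + b)) ->
  (forall X (u : Hom X B) (v : Hom Q X), A X -> K (u ∘ v)) ->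
  sub_add A Y -> forall (u : Hom Y B) (v : Hom Q Y), K (u ∘ v).
Proof.
move=> K0 KD KA [m [X [T [Y' [AX [i [p [_ _ ip]]] sumT]]]]] u v.
case: sumT => i1 [_ [p1 [_ [p1i1 _ _ _ _]]]].
have -> : u ∘ v = \sum_(k < m) (u ∘ p1 ∘ i k) ∘ (p k ∘ i1 ∘ v).
  rewrite -[u in LHS]comp_idr -p1i1 -[i1 in LHS]comp_idl -ip comp_suml.
  rewrite comp_sumr comp_sumr comp_suml.
  by apply: eq_bigr => k _; rewrite !comp_assoc.
by apply: (big_ind K) => // k _; apply: KA.
Qed.

Lemma sub_add_Hom_zero A Y B :
  (forall X, A X -> Hom_zero X B) -> sub_add A Y -> Hom_zero Y B.
Proof.
move=> AB AY u; rewrite -(comp_idr u).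
apply: (sub_add_comp (K := fun w => w = 0) _ _ _ AY) => //.
  by move=> a b -> ->; rewrite addr0.
by move=> X a b AX; rewrite (AB X AX a) comp0l.
Qed.

End AddClosure.

(** * Aisles by degree and truncation triangles *)

Section Truncation.
Variables (D : triangulated_category) (P : subcat D).
Implicit Types (X Y Z V W Q : D) (p q i : int).

Lemma sub_shift_of (A : subcat D) X n : A X⟦- n⟧ -> sub_shift A n X.
Proof.
move=> AX; exists X⟦- n⟧ => //; apply: isomorphic_sym.
by apply: shiftzK; rewrite addNr.
Qed.

(** Absorbing the shift and the isomorphism into the degree turns later membership checks into
    integer inequalities. *)
Lemma DleP q X :
  Dle P q X <-> forall i Q, q < i -> P Q -> Hom_zero Q X⟦i⟧.
Proof.
split=> [[Y leY XY] i Q qi PQ|leX].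
  have /leY/(_ Q PQ) : 0 < - q + i by lia.
  move/Hom_zero_shiftzD; apply: Hom_zero_iso; first exact: isomorphic_refl.
  by apply/shiftz_iso/isomorphic_sym.
apply: sub_shift_of => i i_gt0 Q PQ.
by apply/Hom_zero_shiftzD; apply: leX PQ; lia.
Qed.

Lemma DgeP p X :
  Dge P p X <-> forall i Q, i < p -> P Q -> Hom_zero Q X⟦i⟧.
Proof.
split=> [[Y geY XY] i Q pi PQ|geX].
  have /geY/(_ Q PQ) : - p + i < 0 by lia.
  move/Hom_zero_shiftzD; apply: Hom_zero_iso; first exact: isomorphic_refl.
  by apply/shiftz_iso/isomorphic_sym.
apply: sub_shift_of => i i_gt0 Q PQ.
by apply/Hom_zero_shiftzD; apply: geX PQ; lia.
Qed.

(** Each [P[i]] with [i >= 0] lies in the aisle because [P] is presilting, and the aisle is closed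
    under extensions. *)
Lemma Pterm_Dle0 d : presilting P -> sub_incl (Pterm P d) (Dle P 0).
Proof.
move=> Ppre; elim: d => [|d IHd] X /=.
  move=> PX; apply/DleP => i Q i_gt0 PQ.
  apply: (Ppre i i_gt0 _ _ PQ); exists X => //; exact: isomorphic_refl.
case=> U [W [f [g [h [/IHd/DleP leU [Y PY WY] tri]]]]].
apply/DleP => i Q i_gt0 PQ; apply: (Hom_zero_mid tri); first exact: leU.
apply: (Hom_zero_iso (isomorphic_refl Q) (isomorphic_sym (shiftz_iso i WY))).
apply/Hom_zero_shiftzD; have n_gt0 : 0 < Posz d.+1 + i by lia.
apply: (Ppre _ n_gt0 _ _ PQ); exists Y => //; exact: isomorphic_refl.
Qed.

Hypothesis P_tstr : is_tstructure (Dle0 P) (Dge0 P).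

Lemma Dle_Dge_Hom_zero q X Y : Dle P q X -> Dge P (q + 1) Y -> Hom_zero X Y.
Proof.
move=> /DleP leX /DgeP geY; have [_ _ _ orth _] := P_tstr.
have XY : Hom_zero X⟦q⟧ Y⟦q⟧.
  apply: orth.
    by move=> i i_gt0 Q PQ; apply/Hom_zero_shiftzD; apply: leX PQ; lia.
  (* The coaisle shifted by [-1] is by definition [Dge P 1]. *)
  apply/(DgeP 1) => i Q i_lt1 PQ.
  by apply/Hom_zero_shiftzD; apply: geY PQ; lia.
apply: Hom_zero_iso (Hom_zero_shiftz (n := - q) XY); apply: shiftzK;
  by rewrite subrr.
Qed.

(* Restricted to nonpositive degrees, where the truncation triangle of [X[-n]]
   only has to be shifted forward, by rotations. *)
Lemma truncation_triangle (n : nat) X :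
  exists V Y (f : Hom V X) (g : Hom X Y) (h : Hom Y (shift D V)),
    [/\ Dle P (- n%:Z) V, Dge P (- n%:Z + 1) Y & triangle f g h].
Proof.
have [_ _ _ _ /(_ X⟦- n%:Z⟧)] := P_tstr.
case=> V [Y [f [g [h [leV /(DgeP 1) geY tri]]]]].
have [f' [g' [h' tri']]] := triangle_shift_nat n tri.
have [v iv] : isomorphic X⟦- n%:Z⟧⟦n%:Z⟧ X by apply: shiftzK; rewrite addNr.
have [g'' tri''] := triangle_iso_mid tri' iv.
exists V⟦n%:Z⟧, Y⟦n%:Z⟧, (v ∘ f'), g'', h'; split=> //.
  apply/DleP => i Q ni PQ; apply/Hom_zero_shiftzD; apply: leV PQ; lia.
by apply/DgeP => i Q ni PQ; apply/Hom_zero_shiftzD; apply: geY PQ; lia.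
Qed.

(** The third vertex [Z] of the upper truncation triangle lies in both [Dle P 0] and [Dge P 1],
    hence is zero. So [W -> X] is an isomorphism and only the lower truncation remains. *)
Lemma is_H_triangle p X Y : Dle P 0 X -> is_H P p 0 X Y ->
  exists V (f : Hom V X) (g : Hom X Y) (h : Hom Y (shift D V)),
    Dle P (p - 1) V /\ triangle f g h.
Proof.
move=> /DleP leX [W [Z [f [g [h [leW geZ tri]]]]]].
case=> V [f' [g' [h' [leV geY tri']]]].
have leZ : Dle P 0 Z.
  apply/DleP => i Q i_gt0 PQ; apply: (Hom_zero_last tri); first exact: leX.
  by move/DleP: leW => leW; apply: leW PQ; lia.
have Z0 : is_zero_obj Z by apply/zero_objP; apply: (Dle_Dge_Hom_zero leZ geZ).
have [g'' tri''] := triangle_iso_mid tri' (triangle_iso_of_zero tri Z0).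
by exists V, (f ∘ f'), g'', h'.
Qed.

Lemma is_H_exists (n : nat) X : Dle P 0 X ->
  exists Y, is_H P (- n%:Z + 1) 0 X Y.
Proof.
move=> leX; have [V [Y [f [g [h [leV geY tri]]]]]] := truncation_triangle n X.
have [O O0] := zero_obj_exists D.
exists Y, X.
  exists O, (idm X), 0, 0; split=> //; last exact: triangle_id.
  apply/DgeP => i Q _ _; apply/Hom_zero_adj; exact: (O0 _).1.
by exists V, f, g, h; split=> //; rewrite addrK.
Qed.

End Truncation.

(** * Chains of extriangles *)

Section Fac.
Variables (D : triangulated_category) (P : subcat D) (d : nat).
Implicit Types (A : subcat D) (X O : D).

Lemma Fac_dH s A X : Fac P d s A X -> dH P d X.
Proof. by case: s => [//|s] [X1 [Z1 [_ [_ _ dX _] _]]]. Qed.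

(** The last extriangle is dropped; its third term stays in the extended heart. *)
Lemma FacS s A : sub_incl (Fac P d s.+1 A) (Fac P d s A).
Proof.
elim: s => [|s IHs] X; first exact: Fac_dH.
by case=> X1 [Z1 [AX1 ext /IHs facZ]]; exists X1, Z1.
Qed.

Lemma Fac_cover s A X : (0 < s)%N -> Fac P d s A X ->
  exists X1 Z1, A X1 /\ extriangle P d Z1 X1 X.
Proof. by case: s => [//|s] _ [X1 [Z1 [AX1 ext _]]]; exists X1, Z1. Qed.

(** The chain begins with the trivial extriangle [O -> X -> X] and continues from [O], which is
    again in [A]. *)
Lemma Fac_self s A O : sub_incl A (dH P d) -> is_zero_obj O -> A O ->
  sub_incl A (Fac P d s A).
Proof.
move=> AdH O0 AO; elim: s => [|s IHs] X AX /=; first exact: AdH.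
exists X, O; split=> //; last exact: IHs.
split; try exact: AdH.
by exists 0, (idm X), 0; apply: triangle_zero_left.
Qed.

End Fac.

(** * The two quasi-tilting conditions for an AIR tilting subcategory *)

Section AIRTilting.
Variables (D : triangulated_category) (P : subcat D) (d : nat).
Variables (M S : subcat D).
Hypothesis P_presilting : presilting P.
Hypothesis P_tstr : is_tstructure (Dle0 P) (Dge0 P).
Hypothesis M_dH : subcategory_of_dH P d M.
Hypothesis MS : AIR_tilting_wrt P d M S.
Implicit Types (X Y V U Q : D).

Lemma air_S_Dle0 U : S U -> Dle P 0 U.
Proof. by case: MS => -[[_ _ SP] _] _ _ /SP; apply: Pterm_Dle0. Qed.

Lemma air_M_sub_add X :
  M X -> sub_add (fun Y => exists2 U, S U & is_H P (- d%:Z + 1) 0 U Y) X.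
Proof. by case: MS => -[_ MH] _ _ /MH. Qed.

Lemma air_H_M U Y : S U -> is_H P (- d%:Z + 1) 0 U Y -> M Y.
Proof.
by case: MS => -[_ MH] _ _ SU HY; apply/MH/sub_add_sub; exists U.
Qed.

Lemma air_M_Fac s : sub_incl M (Fac P d s M).
Proof.
have [O O0] := zero_obj_exists D.
have [MM MdH] := M_dH; have MO : M O by apply/MM/sub_add_zero.
by move=> X; apply: (Fac_self s MdH O0 MO).
Qed.

Lemma air_H_triangle U Y : S U -> is_H P (- d%:Z + 1) 0 U Y ->
  exists V (f : Hom V U) (g : Hom U Y) (h : Hom Y (shift D V)),
    [/\ Dle P (- d%:Z) V, triangle f g h
      & forall X, dH P d X -> Hom_zero V X].
Proof.
move=> SU HY.
have [V [f [g [h [leV tri]]]]] := is_H_triangle P_tstr (air_S_Dle0 SU) HY.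
rewrite addrK in leV; exists V, f, g, h; split=> // X [_ geX].
exact: Dle_Dge_Hom_zero leV geX.
Qed.

Lemma air_EE_projective X : M X -> EE_projective_in (Fac P d d M) X.
Proof.
move=> MX; split=> [|Y facY]; first exact: air_M_Fac.
have [_ _ TF] := MS; have [dY TY] := (TF Y).2 facY.
apply: sub_add_Hom_zero (air_M_sub_add MX) => {MX}X [U SU HX].
have [V [f [g [h [_ tri VY]]]]] := air_H_triangle SU HX.
move=> u; have /triangle_rot tri' := tri.
(* Since [Y] is in [T(S)], [u] vanishes on [U], so it factors through [V[1]]; maps from there to
   [Y[1]] are shifts of maps [V -> Y], hence zero. *)
have [v ->] := triangle_desc tri' (TY 1 isT U SU (u ∘ g)).
by rewrite (Hom_zero_shift (VY Y dY) v) comp0l.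
Qed.

Lemma air_FacS : (0 < d)%N -> sub_incl (Fac P d d M) (Fac P d d.+1 M).
Proof.
move=> d_gt0 X facX.
have [_ cfinS TF] := MS; have [dX TX] := (TF X).2 facX.
have [U [a [SU approx]]] := cfinS X.
have [H HU] := is_H_exists P_tstr d (air_S_Dle0 SU).
have MH := air_H_M SU HU.
have dH_H : dH P d H by case: M_dH => _; apply.
(* Being in [M], [H] lies in [Fac_d(M) = T(S)], which supplies the vanishing of [Hom(S, H[i])] for
   [i > 0]. *)
have [dH' TH] := (TF H).2 (air_M_Fac d MH).
have [V [f [q [h [_ tri VX]]]]] := air_H_triangle SU HU.
have [b ab] := triangle_desc tri (VX X dX (a ∘ f)).
have [Y [y [z triY]]] := triangle_cocone b.
have Plift Q : P Q -> forall v : Hom Q X, exists w, v = b ∘ w.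
  move=> PQ v; have [X1 [Z1 [MX1 ext]]] := Fac_cover d_gt0 facX.
  (* As [d > 0], there is an extriangle ending in [X] with middle term in [M]; [Hom(Q, Z1[1]) = 0]
     lifts [v] to [X1]. *)
  have [[/DleP leZ _] _ _ [f1 [g1 [h1 /triangle_rot tri1]]]] := ext.
  have [v1 ->] := triangle_lift tri1 (leZ 1 Q isT PQ (h1 ∘ v)).
  apply: (sub_add_comp (K := fun t => exists w, t = b ∘ w) _ _ _
    (air_M_sub_add MX1)).
  - by exists 0; rewrite comp0r.
  - by move=> _ _ [w ->] [w' ->]; exists (w + w'); rewrite comp_addr.
  move=> H' c {}v [U' SU' HU'].
  have [V' [f' [q' [h' [/DleP leV' /triangle_rot tri' _]]]]] :=
    air_H_triangle SU' HU'.
  (* Degree [1] exceeds [-d], so [v] lifts further to [U'], where the approximation property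
     applies. *)
  have QV' : Hom_zero Q V'⟦1⟧ by apply: leV' PQ; lia.
  have [w ->] := triangle_lift tri' (QV' (h' ∘ v)).
  have [s cs] := approx _ (c ∘ q') SU'.
  by exists (q ∘ s ∘ w); rewrite !comp_assoc cs ab.
have Slift U' : S U' -> forall v : Hom U' X, exists w, v = b ∘ w.
  move=> SU' v; have [s ->] := approx _ v SU'.
  by exists (q ∘ s); rewrite ab comp_assoc.
have [/DleP leH /DgeP geH] := dH_H.
have [/DleP leX /DgeP geX] := dX.
have dY : dH P d Y.
  split; [apply/DleP|apply/DgeP] => i Q.
    (* In degree [1] exactness alone would require [Hom(Q, X) = 0]; lifting along [b] takes its
       place. In the other degrees, the vanishing for [X[i-1]] and [H[i]] suffices. *)
    have [->|] := eqVneq i 1 => [_ PQ|i1 i_gt0 PQ].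
      apply: (Hom_zero_shift_first triY) (Plift Q PQ) _.
      exact: leH.
    have -> : i = 1 + (i - 1) by lia.
    by apply: (Hom_zero_first triY); [apply: leX|apply: leH] => //; lia.
  move=> i_lt PQ; have -> : i = 1 + (i - 1) by lia.
  by apply: (Hom_zero_first triY); [apply: geX|apply: geH] => //; lia.
exists H, Y; split=> //; first by split=> //; exists y, b, z.
apply/TF; split=> // i i_gt0 U' SU'.
(* The same case split, with lifts of maps from [S] in degree [1]. *)
have [->|i1] := eqVneq i 1.
  by apply: (Hom_zero_shift_first triY) (Slift U' SU') _; apply: TH.
have -> : i = 1 + (i - 1) by lia.
by apply: (Hom_zero_first triY); [apply: TX|apply: TH] => //; lia.
Qed.

End AIRTilting.

Theorem proposition3p2 (D : triangulated_category) (P : subcat D)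
    (P_subcat : is_subcategory P)
    (P_presilting : presilting P)
    (P_cfin : contravariantly_finite P)
    (P_bounded : exists2 m : int, m < 0 &
       forall i : int, i < m -> sub_Hom_zero P (sub_shift P i))
    (P_tstr : is_tstructure (Dle0 P) (Dge0 P))
    (P_nondeg : is_nondegenerate (Dle0 P) (Dge0 P))
    (d : nat) (d_gt0 : (0 < d)%N) (M : subcat D) :
  AIR_tilting P d M -> quasi_tilting P d M.
Proof.
move=> [M_dH [S MS]]; split=> // [X MX|X].
  exact: (air_EE_projective P_presilting P_tstr M_dH MS MX).
split; last exact: FacS.
exact: (air_FacS P_presilting P_tstr M_dH MS).
Qed.
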